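(* Let $H(P)=\frac12\|P\|_*^2$ for $P\in\mathbb{R}^N\otimes\mathbb{R}^n$. Let $u\in C^2(\mathbb{R}^n)^N$ and suppose that there exists $e\in C^1(\mathbb{R}^n)^N$ with $|e|\equiv 1$ such that $\|Du\|_*^2=(Du\,Du^\top):e\otimes e$ on $\mathbb{R}^n$, the maximum eigenvalue of $Du(x)Du(x)^\top$ being simple for every $x\in\mathbb{R}^n$ (so that $e$ is unique up to sign). Then $$\mathrm{A}_{\top,\infty}u \;=\; e\otimes e\,\big(\Delta_{\infty_{T^*}}u\big)\quad\text{on }\mathbb{R}^n,$$ that is, the tangential Aronsson operator of $H$ applied to $u$ equals the projection on $\mathrm{span}[e]$ of $\Delta_{\infty_{T^*}}u$.
   Context: $\mathbb{R}^N\otimes\mathbb{R}^n$ is the space of real $N\times n$ matrices; $A:B$ is the Euclidean inner product of matrices; $a\otimes b$ is the matrix $(a_\alpha b_\beta)$. Repeated indices are summed (Greek from $1$ to $N$, Latin from $1$ to $n$). The dual operator norm is $$\|P\|_*:=\max_{\xi\in\mathbb{S}^{N-1}}|\xi^\top P|=\big(\max\sigma(PP^\top)\big)^{1/2},$$ where $\sigma$ denotes the spectrum. For a Hamiltonian $H=H(P)$ the tangential Aronsson operator is $$(\mathrm{A}_{\top,\infty}u)_\alpha:=H_{P_{\alpha i}}(Du)\,H_{P_{\beta j}}(Du)\,D^2_{ij}u_\beta,\qquad \alpha=1,\dots,N,$$ with $H_{P_{\alpha i}}=\partial H/\partial P_{\alpha i}$. The dual $\infty$-Laplacian (governing Tight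 Maps) is $$\Delta_{\infty_{T^*}}u:=\Big[(e^\top Du)\otimes(e^\top Du):(e^\top D^2u)\Big]e+e^\perp\,\mathrm{Div}\big(e\otimes e\,Du\big),$$ where $e^\top Du$ is the vector $(e_\beta D_iu_\beta)_i\in\mathbb{R}^n$, $e^\top D^2u$ is the $n\times n$ matrix $(e_\beta D^2_{ij}u_\beta)_{ij}$, $e^\perp:=I-e\otimes e$, and $\big(\mathrm{Div}(e\otimes e\,Du)\big)_\alpha=D_i\big(e_\alpha e_\beta D_iu_\beta\big)$. *)

(* Defs.v *)
From HB Require Import structures.
From mathcomp Require Import all_boot all_order all_algebra.
From mathcomp Require Import all_classical all_reals all_analysis.
Import Order.TTheory GRing.Theory Num.Theory.
Import numFieldNormedType.Exports.

Set Implicit Arguments.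
Unset Strict Implicit.
Unset Printing Implicit Defensive.

Local Open Scope classical_set_scope.
Local Open Scope ring_scope.

(* Vectors of R^n are columns 'cV[R]_n.  The canonical norm `|_| on matrices
   is the sup norm; Euclidean lengths are therefore taken with [enorm]. The
   two norms define the same topology and the same derivatives. *)

Section MatrixAlgebra.
Context {R : realType}.

(* A : B *)
Definition frob m n (A B : 'M[R]_(m, n)) : R :=
  \sum_(i < m) \sum_(j < n) A i j * B i j.

Definition enorm m n (A : 'M[R]_(m, n)) : R := Num.sqrt (frob A A).

(* a (x) b *)
Definition outer m n (a : 'cV[R]_m) (b : 'cV[R]_n) : 'M[R]_(m, n) := a *m b^T.

Definition sphere N : set 'cV[R]_N := [set xi | enorm xi = 1].

(* The maximum over the compact unit sphere is attained when 0 < N, hence it is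
   the supremum. *)
Definition dual_norm N n (P : 'M[R]_(N, n)) : R :=
  sup [set enorm (xi^T *m P) | xi in @sphere N].

Definition max_eigenvalue N (A : 'M[R]_N) (lam : R) : Prop :=
  eigenvalue A lam /\ forall mu, eigenvalue A mu -> mu <= lam.

(* Simple: a root of multiplicity one of the characteristic polynomial. *)
Definition max_eigenvalue_simple N (A : 'M[R]_N) : Prop :=
  exists lam, max_eigenvalue A lam /\ mup lam (char_poly A) = 1%N.

End MatrixAlgebra.

Section Calculus.
Context {R : realType}.

Definition partial n (i : 'I_n) (f : 'cV[R]_n -> R) : 'cV[R]_n -> R :=
  'D_(delta_mx i 0) f.

(* All iterated partial derivatives up to order k exist and are continuous. *)
Fixpoint is_C n (k : nat) (f : 'cV[R]_n -> R) : Prop :=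
  continuous f /\
  if k is k'.+1 then
    forall i : 'I_n,
      (forall x, derivable f x (delta_mx i 0)) /\ is_C k' (partial i f)
  else True.

Definition is_Cvec n N (k : nat) (u : 'cV[R]_n -> 'cV[R]_N) : Prop :=
  forall a : 'I_N, is_C k (fun x => u x a 0).

(* Du = (D_i u_a)_{a i} *)
Definition grad n N (u : 'cV[R]_n -> 'cV[R]_N) (x : 'cV[R]_n) : 'M[R]_(N, n) :=
  \matrix_(a, i) partial i (fun y => u y a 0) x.

(* D^2_{ij} u_b *)
Definition D2 n N (u : 'cV[R]_n -> 'cV[R]_N) (i j : 'I_n) (b : 'I_N)
    (x : 'cV[R]_n) : R :=
  partial i (partial j (fun y => u y b 0)) x.

Definition Div n N (F : 'cV[R]_n -> 'M[R]_(N, n)) (x : 'cV[R]_n) : 'cV[R]_N :=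
  \col_a \sum_(i < n) partial i (fun y => F y a i) x.

(* H_P(P) = (dH/dP_{a i}) *)
Definition H_P N n (H : 'M[R]_(N, n) -> R) (P : 'M[R]_(N, n)) : 'M[R]_(N, n) :=
  \matrix_(a, i) 'D_(delta_mx a i) H P.

Definition tangential_Aronsson N n (H : 'M[R]_(N, n) -> R)
    (u : 'cV[R]_n -> 'cV[R]_N) (x : 'cV[R]_n) : 'cV[R]_N :=
  \col_a \sum_(b < N) \sum_(i < n) \sum_(j < n)
    H_P H (grad u x) a i * H_P H (grad u x) b j * D2 u i j b x.

Definition dual_hamiltonian N n (P : 'M[R]_(N, n)) : R :=
  2^-1 * dual_norm P ^+ 2.

Definition dual_infty_laplacian n N (e u : 'cV[R]_n -> 'cV[R]_N)
    (x : 'cV[R]_n) : 'cV[R]_N :=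
  let eDu : 'cV[R]_n := ((e x)^T *m grad u x)^T in
  let eD2u : 'M[R]_n := \matrix_(i, j) \sum_(b < N) e x b 0 * D2 u i j b x in
  frob (outer eDu eDu) eD2u *: e x
  + (1%:M - outer (e x) (e x))
      *m Div (fun y => outer (e y) (e y) *m grad u y) x.

End Calculus.

(* Main.v *)
(* Once [H_P(P) = e (x) (e^T P)] is known for [H = dual_norm^2 / 2], both sides of
   the identity are the same contraction of [e], [e^T Du] and [D^2 u], because
   [e^T e^perp = 0].  For the derivative, [H] is the supremum of the quadratic
   forms [|x^T P|^2 / 2] over unit [x]: testing with [x = e] bounds
   [dual_norm (P + h E)^2] from below to first order in [h], and simplicity of
   the top eigenvalue gives a gap [|x^T P|^2 <= dual_norm P ^ 2 - g |x - e|^2]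
   (up to the sign of [x]), which absorbs the first-order cross terms
   [O(h |x - e|)] into an [O(h^2)] error, hence the matching upper bound. *)
Require Import Defs.
From HB Require Import structures.
From mathcomp Require Import all_boot all_order all_algebra.
From mathcomp Require Import all_classical all_reals all_analysis.
From mathcomp Require Import ring lra.
Import Order.TTheory GRing.Theory Num.Theory.
Import numFieldNormedType.Exports.
Local Open Scope classical_set_scope.
Local Open Scope ring_scope.

Set Implicit Arguments.
Unset Strict Implicit.
Unset Printing Implicit Defensive.

(* A basis [S] extending one of the eigenspace makes each of the first [\rank E]
   rows of [S *m ('X - A)] divisible by ['X - a]. *)
Lemma mxrank_eigenspace_le_mup (F : fieldType) (n : nat) (A : 'M[F]_n) (a : F) :
  (\rank (eigenspace A a) <= mup a (char_poly A))%N.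
Proof.
set E := eigenspace A a; set r := \rank E; set S := row_ebase E.
rewrite mup_geq ?monic_neq0 ?char_poly_monic //.
have HSA (i j : 'I_n) : (i < r)%N -> (S *m A) i j = a * S i j.
  move=> ir.
  have hsub : ((pid_mx r : 'M[F]_n) *m S <= E)%MS.
    have -> : (pid_mx r : 'M[F]_n) *m S = invmx (col_ebase E) *m E.
      by rewrite -[X in _ = _ *m X](mulmx_ebase E) -mulmxA mulKmx ?col_ebase_unit.
    exact: submxMl.
  have /(congr1 (row i)) := eigenspaceP hsub.
  have rowpid : row i (pid_mx r : 'M[F]_n) = delta_mx 0 i.
    by apply/rowP => k; rewrite !mxE eqxx ir andbT eq_sym val_eqE.
  rewrite linearZ /= !row_mul rowpid -rowE -row_mul => /rowP/(_ j).
  by rewrite !mxE.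
pose D : 'rV[{poly F}]_n := \row_i if (i < r)%N then 'X - a%:P else 1.
pose G : 'M[{poly F}]_n := \matrix_(i, j)
  if (i < r)%N then (S i j)%:P else (map_mx polyC S *m char_poly_mx A) i j.
have eqDG : map_mx polyC S *m char_poly_mx A = diag_mx D *m G.
  apply/matrixP => i j; rewrite mul_diag_mx [in RHS]mxE [D 0 i]mxE [G i j]mxE.
  case: ifP => ir; last by rewrite mul1r.
  rewrite mulmxBr -map_mxM mul_mx_scalar.
  rewrite [in LHS]mxE [X in X + _]mxE [X in _ + X]mxE.
  by rewrite [X in - X]mxE [X in - X%:P]HSA // mxE polyCM mulrBl.
have /(congr1 determinant) := eqDG.
rewrite !det_mulmx det_map_mx /= -/(char_poly A) det_diag => e1.
have Su : \det S != 0 by rewrite -unitfE -unitmxE row_ebase_unit.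
rewrite -(dvdpZr _ _ Su) -mul_polyC e1 dvdp_mulr //.
under eq_bigr do rewrite mxE.
rewrite -big_mkcond /= -(big_ord_widen n (fun=> _)) ?rank_leq_col //.
by rewrite prodr_const card_ord.
Qed.

(** * Frobenius inner product and Cauchy-Schwarz inequalities *)

Section Frobenius.
Context {R : realType}.

Lemma frobE m n (A B : 'M[R]_(m, n)) : frob A B = \tr (A *m B^T).
Proof.
by apply: eq_bigr => i _; rewrite mxE; apply: eq_bigr => j _; rewrite mxE.
Qed.

Lemma frobC m n (A B : 'M[R]_(m, n)) : frob A B = frob B A.
Proof. by rewrite !frobE -mxtrace_tr trmx_mul trmxK. Qed.

Lemma frob_tr m n (A B : 'M[R]_(m, n)) : frob A^T B^T = frob A B.
Proof. by rewrite frobC !frobE trmxK mxtrace_mulC. Qed.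

Lemma frobDl m n (A B C : 'M[R]_(m, n)) : frob (A + B) C = frob A C + frob B C.
Proof. by rewrite !frobE mulmxDl raddfD. Qed.

Lemma frobZl m n c (A B : 'M[R]_(m, n)) : frob (c *: A) B = c * frob A B.
Proof. by rewrite !frobE -scalemxAl linearZ. Qed.

Lemma frobDr m n (A B C : 'M[R]_(m, n)) : frob A (B + C) = frob A B + frob A C.
Proof. by rewrite frobC frobDl !(frobC A). Qed.

Lemma frobZr m n c (A B : 'M[R]_(m, n)) : frob A (c *: B) = c * frob A B.
Proof. by rewrite frobC frobZl frobC. Qed.

Lemma frob0l m n (B : 'M[R]_(m, n)) : frob 0 B = 0.
Proof. by rewrite -(scale0r B) frobZl mul0r. Qed.

Lemma frobNl m n (A B : 'M[R]_(m, n)) : frob (- A) B = - frob A B.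
Proof. by rewrite -scaleN1r frobZl mulN1r. Qed.

Lemma frobNr m n (A B : 'M[R]_(m, n)) : frob A (- B) = - frob A B.
Proof. by rewrite frobC frobNl frobC. Qed.

Lemma frob_mul m n p (A : 'M[R]_(m, n)) (B : 'M[R]_(n, p)) (C : 'M[R]_(m, p)) :
  frob (A *m B) C = frob A (C *m B^T).
Proof. by rewrite !frobE trmx_mul trmxK mulmxA. Qed.

Lemma frob_trmulC m n p (A : 'M[R]_(m, n)) (B : 'M[R]_(m, p)) (C : 'M[R]_(n, p)) :
  frob (A^T *m B) C = frob B (A *m C).
Proof. by rewrite !frobE trmx_mul mulmxA -mulmxA mxtrace_mulC. Qed.

Lemma frob_delta m n (A : 'M[R]_(m, n)) a i :
  frob A (delta_mx a i) = A a i.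
Proof.
rewrite /frob (bigD1 a) //= [X in _ + X]big1 => [|k /negPf ka]; last first.
  by apply: big1 => l _; rewrite mxE ka mulr0.
rewrite addr0 (bigD1 i) //= big1 => [|l /negPf li]; last first.
  by rewrite mxE li andbF mulr0.
by rewrite mxE !eqxx mulr1 addr0.
Qed.

Lemma frob_ge0 m n (A : 'M[R]_(m, n)) : 0 <= frob A A.
Proof. by do 2![apply: sumr_ge0 => ? _]; rewrite -expr2 sqr_ge0. Qed.

Lemma frob_eq0 m n (A : 'M[R]_(m, n)) : frob A A = 0 -> A = 0.
Proof.
move=> A0; apply/matrixP => i j; rewrite mxE.
have sq0 k l : 0 <= A k l * A k l by rewrite -expr2 sqr_ge0.
have /psumr_eq0P/(_ i isT) := A0.
move=> /(_ (fun k _ => sumr_ge0 _ (fun l _ => sq0 k l))).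
move=> /psumr_eq0P => /(_ (fun l _ => sq0 i l)) /(_ j isT) /eqP.
by rewrite mulf_eq0 orbb => /eqP.
Qed.

Lemma sqr_enorm m n (A : 'M[R]_(m, n)) : enorm A ^+ 2 = frob A A.
Proof. by rewrite sqr_sqrtr ?frob_ge0. Qed.

Lemma enorm_eq1 m n (A : 'M[R]_(m, n)) : enorm A = 1 <-> frob A A = 1.
Proof.
split=> [A1|A1]; first by rewrite -sqr_enorm A1 expr1n.
by rewrite /enorm A1 sqrtr1.
Qed.

(** Tested at the minimiser [- b / c]; if [c = 0] and [b != 0], the chosen [t] makes the affine
    expression equal to [-1]. *)
Lemma quadratic_ge0_discr (a b c : R) : 0 <= c ->
  (forall t, 0 <= a + 2 * t * b + t ^+ 2 * c) -> b ^+ 2 <= a * c.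
Proof.
move=> c_ge0 H; have [c0|c_neq0] := eqVneq c 0.
  have [->|b0] := eqVneq b 0; first by rewrite c0 expr0n mulr0.
  have := H (- (a + 1) / (2 * b)); rewrite c0 mulr0 addr0.
  have -> : 2 * (- (a + 1) / (2 * b)) * b = - (a + 1) by field.
  by lra.
have c_gt0 : 0 < c by rewrite lt_neqAle eq_sym c_neq0.
have := H (- b / c).
have -> : a + 2 * (- b / c) * b + (- b / c) ^+ 2 * c = (a * c - b ^+ 2) / c.
  by field.
by rewrite pmulr_lge0 ?invr_gt0 // subr_ge0.
Qed.

(** Discriminant of the form along [x + t *: y]. Allowing any semidefinite [M] covers the Euclidean
    case [M = 1] as well as the kernel and coercivity bounds. *)
Lemma psd_CauchySchwarz n p (M : 'M[R]_n) (x y : 'M[R]_(n, p)) :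
  M^T = M -> (forall z : 'M[R]_(n, p), 0 <= frob z (M *m z)) ->
  frob x (M *m y) ^+ 2 <= frob x (M *m x) * frob y (M *m y).
Proof.
move=> Msym Mpsd; apply: quadratic_ge0_discr => // t.
have sym : frob y (M *m x) = frob x (M *m y).
  by rewrite -frob_trmulC Msym frobC.
have := Mpsd (x + t *: y).
rewrite mulmxDr -scalemxAr !(frobDl, frobDr, frobZl, frobZr) sym.
by congr (_ <= _); ring.
Qed.

Lemma frob_CauchySchwarz m n (A B : 'M[R]_(m, n)) :
  frob A B ^+ 2 <= frob A A * frob B B.
Proof.
have := @psd_CauchySchwarz m n 1%:M A B (trmx1 _ _).
by rewrite !mul1mx; apply=> z; rewrite mul1mx frob_ge0.
Qed.

Lemma normr_frob_le m n (A B : 'M[R]_(m, n)) : `|frob A B| <= enorm A * enorm B.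
Proof.
rewrite -(@ler_pXn2r _ 2) ?nnegrE ?mulr_ge0 ?sqrtr_ge0 //.
by rewrite real_normK ?num_real // exprMn !sqr_enorm frob_CauchySchwarz.
Qed.

Lemma enorm_mul_le m n p (A : 'M[R]_(m, n)) (B : 'M[R]_(n, p)) :
  enorm (A *m B) <= enorm A * enorm B.
Proof.
rewrite -(@ler_pXn2r _ 2) ?nnegrE ?mulr_ge0 ?sqrtr_ge0 // exprMn !sqr_enorm.
rewrite /frob mulr_suml; apply: ler_sum => i _.
rewrite [X in _ * X]exchange_big mulr_sumr; apply: ler_sum => j _.
have := frob_CauchySchwarz (row i A) (col j B)^T.
rewrite /frob !big_ord1 -expr2 mxE.
by congr (_ ^+ 2 <= _ * _); apply: eq_bigr => k _; rewrite !mxE.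
Qed.

End Frobenius.

(** * Kernel and coercivity of positive semidefinite forms *)

Section PsdForms.
Context {R : realType}.

(** Cauchy-Schwarz for the pair [M *m x], [x] bounds the fourth power of the length of [M *m x] by a
    multiple of the form at [x]. *)
Lemma psd_kernel n p (M : 'M[R]_n) (x : 'M[R]_(n, p)) :
  M^T = M -> (forall z : 'M[R]_(n, p), 0 <= frob z (M *m z)) ->
  frob x (M *m x) = 0 -> M *m x = 0.
Proof.
move=> Msym Mpsd x0; apply: frob_eq0; apply/eqP.
have := psd_CauchySchwarz (M *m x) x Msym Mpsd.
by rewrite x0 mulr0 -sqrf_eq0 eq_le sqr_ge0 => ->.
Qed.

(* Cauchy-Schwarz for the form [M] applied to [x] and [M^-1 x] bounds the form
   below by [1 / |M^-1|], without any appeal to compactness. *)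
Lemma psd_coercive n p (M : 'M[R]_n) :
  M^T = M -> (forall z : 'M[R]_(n, p), 0 <= frob z (M *m z)) -> M \in unitmx ->
  exists2 g, 0 < g & forall x : 'M[R]_(n, p), g * frob x x <= frob x (M *m x).
Proof.
move=> Msym Mpsd Mu; pose C := enorm (invmx M) + 1.
have C_gt0 : 0 < C by rewrite ltr_wpDl ?sqrtr_ge0.
exists C^-1; first by rewrite invr_gt0.
move=> x; rewrite ler_pdivrMl //.
have := psd_CauchySchwarz x (invmx M *m x) Msym Mpsd; rewrite mulKVmx //.
have := frob_ge0 x; rewrite le_eqVlt => /predU1P[<- _|x_gt0 CS].
  by rewrite mulr_ge0 // ltW.
have inv_le : frob (invmx M *m x) x <= C * frob x x.
  apply: le_trans (ler_norm _) _; apply: le_trans (normr_frob_le _ _) _.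
  rewrite -(sqr_enorm x) expr2 mulrA ler_wpM2r ?sqrtr_ge0 //.
  apply: le_trans (enorm_mul_le _ _) _.
  by rewrite ler_wpM2r ?sqrtr_ge0 // lerDl.
rewrite -(ler_pM2r x_gt0) -expr2; apply: le_trans CS _.
by rewrite -mulrA mulrCA ler_wpM2l.
Qed.

End PsdForms.

(** * The dual norm as a supremum of quadratic forms *)

Section DualNorm.
Context {R : realType} {N n : nat}.
Implicit Types (P E : 'M[R]_(N, n)) (e x : 'cV[R]_N).

Lemma enorm_tr m p (A : 'M[R]_(m, p)) : enorm A^T = enorm A.
Proof. by rewrite /enorm frob_tr. Qed.

Lemma dual_norm_ub P x : enorm x = 1 -> enorm (x^T *m P) <= dual_norm P.
Proof.
move=> x1; apply: sup_ubound; last by exists x.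
exists (enorm P) => _ [y /= y1 <-].
by apply: le_trans (enorm_mul_le _ _) _; rewrite enorm_tr y1 mul1r.
Qed.

Lemma dual_norm_sqr_ge P x :
  frob (x^T *m P) (x^T *m P) <= dual_norm P ^+ 2 * frob x x.
Proof.
have := frob_ge0 x; rewrite le_eqVlt => /predU1P[x0|x_gt0].
  by rewrite (frob_eq0 (esym x0)) trmx0 mul0mx !frob0l mulr0.
have c_gt0 : 0 < enorm x by rewrite sqrtr_gt0.
have y1 : enorm ((enorm x)^-1 *: x) = 1.
  by apply/enorm_eq1; rewrite frobZl frobZr -sqr_enorm; field; rewrite gt_eqF.
have := dual_norm_ub P y1.
rewrite -(@ler_pXn2r _ 2) ?nnegrE ?sqrtr_ge0 //; last first.
  by apply: le_trans (dual_norm_ub P y1); rewrite sqrtr_ge0.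
rewrite sqr_enorm linearZ /= -scalemxAl frobZl frobZr mulrA.
by rewrite -expr2 exprVn sqr_enorm ler_pdivrMl // mulrC.
Qed.

(** The unit vector [e] makes the set under the supremum nonempty and forces [0 <= c], so that [c]
    has a genuine square root. *)
Lemma dual_norm_sqr_le P e c : enorm e = 1 ->
  (forall x, enorm x = 1 -> frob (x^T *m P) (x^T *m P) <= c) ->
  dual_norm P ^+ 2 <= c.
Proof.
move=> e1 H.
have c_ge0 : 0 <= c by apply: le_trans (H e e1); apply: frob_ge0.
rewrite -(sqr_sqrtr c_ge0) ler_pXn2r ?nnegrE ?sqrtr_ge0 //; last first.
  by apply: le_trans (dual_norm_ub P e1); rewrite sqrtr_ge0.
apply: ge_sup; first by exists (enorm (e^T *m P)), e.
by move=> _ [x x1 <-]; rewrite ler_wsqrtr // H.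
Qed.

(** * Spectral gap at a simple top eigenvalue *)

Section SimpleTopEigenvalue.
Variables (P : 'M[R]_(N, n)) (e : 'cV[R]_N).
Hypothesis e1 : enorm e = 1.
Hypothesis eP : frob (e^T *m P) (e^T *m P) = dual_norm P ^+ 2.
Hypothesis simpleP : max_eigenvalue_simple (P *m P^T).

Let lam := dual_norm P ^+ 2.
(** The deficit form: nonnegative, and zero at the maximiser [e]. Its coercivity transversally to
    [e] is the spectral gap. *)
Let B := lam%:M - P *m P^T.

Let Bsym : B^T = B.
Proof. by rewrite /B linearB /= tr_scalar_mx trmx_mul trmxK. Qed.

Let frobB x : frob x (B *m x) = lam * frob x x - frob (x^T *m P) (x^T *m P).
Proof.
rewrite mulmxBl frobDr frobNr mul_scalar_mx frobZr; congr (_ - _).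
by rewrite -[RHS]frob_tr trmx_mul trmxK -mulmxA -frob_trmulC.
Qed.

Let Bpsd x : 0 <= frob x (B *m x).
Proof. by rewrite frobB subr_ge0 dual_norm_sqr_ge. Qed.

Let Be0 : B *m e = 0.
Proof.
by apply: psd_kernel => //; rewrite frobB -/lam eP -sqr_enorm e1 expr1n mulr1 subrr.
Qed.

(** [eigenspace] consists of row vectors, hence the transposes; [P *m P^T] is symmetric, so left and
    right eigenvectors agree. *)
Let kerB_eigenspace x : B *m x = 0 -> (x^T <= eigenspace (P *m P^T) lam)%MS.
Proof.
move=> Bx; apply/eigenspaceP/trmx_inj.
rewrite trmx_mul trmx_mul !trmxK linearZ /= trmxK; apply/eqP.
by rewrite -mul_scalar_mx eq_sym -subr_eq0 -mulmxBl Bx.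
Qed.

Let e_neq0 : e != 0.
Proof.
apply/eqP => e0; move: e1; rewrite /enorm e0 frob0l sqrtr0 => /eqP.
by rewrite eq_sym oner_eq0.
Qed.

(** The simple top eigenvalue [mu] is [lam]: [e^T] is an eigenvector for [lam], and an eigenvector
    for [mu] tested in the dual norm gives [mu <= lam]. *)
Let mup_lam : mup lam (char_poly (P *m P^T)) = 1%N.
Proof.
have [mu [[mu_eig mu_max] mup_mu]] := simpleP.
suff -> : lam = mu by [].
apply/eqP; rewrite eq_le mu_max /=; last first.
  apply/eigenvalueP; exists e^T; last by rewrite trmx_eq0.
  exact/eigenspaceP/kerB_eigenspace.
have [v vP v0] := eigenvalueP mu_eig.
have v_gt0 : 0 < frob v^T v^T.
  rewrite lt_neqAle frob_ge0 andbT eq_sym; apply: contra v0 => /eqP/frob_eq0 /eqP.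
  by rewrite trmx_eq0.
rewrite -(ler_pM2r v_gt0); apply: le_trans (dual_norm_sqr_ge P v^T).
by rewrite trmxK [leRHS]frob_mul -mulmxA vP frobZr frob_tr.
Qed.

(** The eigenspace has dimension at most the multiplicity one and contains the nonzero [e^T]. *)
Let kerB_colinear x : B *m x = 0 -> exists c, x = c *: e.
Proof.
move=> Bx.
have eE := kerB_eigenspace Be0.
have rk : \rank (eigenspace (P *m P^T) lam) == \rank e^T.
  rewrite eqn_leq (mxrankS eE) andbT rank_rV trmx_eq0 e_neq0.
  by rewrite (leq_trans (mxrank_eigenspace_le_mup _ _)) ?mup_lam.
have := mxrank_leqif_sup eE => -[_]; rewrite eq_sym rk => /esym le_e.
have /sub_rVP[c] := submx_trans (kerB_eigenspace Bx) le_e.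
by move/(congr1 trmx); rewrite linearZ /= !trmxK => ->; exists c.
Qed.

(* The projection onto [e] makes [B] definite without changing it on the
   orthogonal complement of [e]. *)
Let M := B + outer e e.

Let frobM x : frob x (M *m x) = frob x (B *m x) + frob e x ^+ 2.
Proof.
rewrite mulmxDl frobDr; congr (_ + _).
rewrite /outer -mulmxA -frob_trmulC.
have -> : e^T *m x = (frob e x)%:M.
  by rewrite [LHS]mx11_scalar frobC frobE mxtrace_mulC trace_mx11.
by rewrite /frob !big_ord1 mxE eqxx mulr1n.
Qed.

(** For invertibility: on a kernel vector both nonnegative summands of [frobM] vanish; the first
    puts it on the line of [e], the second kills its coefficient. *)
Let M_coercive : exists2 g, 0 < g & forall x, g * frob x x <= frob x (M *m x).
Proof.
apply: psd_coercive.
- by rewrite /M linearD /= Bsym trmx_mul trmxK.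
- by move=> x; rewrite frobM addr_ge0 ?sqr_ge0.
rewrite -row_free_unit; apply: inj_row_free => v vM.
have Mv : M *m v^T = 0.
  apply: trmx_inj.
  by rewrite trmx_mul trmxK linearD /= Bsym trmx_mul trmxK vM trmx0.
have /eqP := frobM v^T; rewrite Mv frobC frob0l eq_sym paddr_eq0 ?sqr_ge0 //.
case/andP => /eqP/(psd_kernel Bsym Bpsd)/kerB_colinear[c vE].
rewrite vE frobZr -sqr_enorm e1 expr1n mulr1 sqrf_eq0 => /eqP c0.
by apply: trmx_inj; rewrite vE c0 scale0r trmx0.
Qed.

(** Coercivity is applied to the part [w] of [x] orthogonal to [e], where [M] and [B] agree. The
    sign condition separates the maximiser [e] from [- e]. *)
Lemma spectral_gap : exists2 g, 0 < g &
  forall x, enorm x = 1 -> 0 <= frob e x ->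
  frob (x^T *m P) (x^T *m P) <= dual_norm P ^+ 2 - g * frob (x - e) (x - e).
Proof.
have [g g_gt0 gM] := M_coercive; exists (g / 2); first by rewrite divr_gt0.
move=> x /enorm_eq1 x1; set c := frob e x => c_ge0.
have ee : frob e e = 1 by apply/enorm_eq1.
have c_le1 : c <= 1.
  by have := frob_CauchySchwarz e x; rewrite ee x1 mulr1 expr_le1.
pose w := x - c *: e.
have ew : frob e w = 0 by rewrite frobDr frobNr frobZr ee mulr1 subrr.
have ww : frob w w = 1 - c ^+ 2.
  rewrite {1}/w frobDl frobNl frobZl ew mulr0 oppr0 addr0 frobDr frobNr frobZr.
  by rewrite x1 (frobC x).
have Bw : frob w (B *m w) = lam - frob (x^T *m P) (x^T *m P).
  have -> : B *m w = B *m x by rewrite mulmxBr -scalemxAr Be0 scaler0 subr0.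
  rewrite -frob_trmulC Bsym mulmxBr -scalemxAr Be0 scaler0 subr0.
  by rewrite frobC frobB x1 mulr1.
have := gM w; rewrite frobM ew expr0n addr0 Bw ww.
have -> : frob (x - e) (x - e) = 2 - 2 * c.
  by rewrite !(frobDl, frobDr, frobNl, frobNr) ee x1 (frobC x) -/c; ring.
(* For [0 <= c <= 1], [1 - c ^+ 2] is at least [1 - c], which is half of the squared distance from
   [x] to [e]; hence the constant [g / 2]. *)
have : 0 <= g * (c * (1 - c)).
  by rewrite mulr_ge0 ?(ltW g_gt0) // mulr_ge0 // subr_ge0.
by rewrite -/lam; lra.
Qed.

End SimpleTopEigenvalue.
End DualNorm.

(** * Derivative of the dual Hamiltonian *)

Section Derivative.
Context {R : realType} {N n : nat}.

Lemma dual_norm_sqr_expansion (P : 'M[R]_(N, n)) (e : 'cV[R]_N) :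
  enorm e = 1 -> frob (e^T *m P) (e^T *m P) = dual_norm P ^+ 2 ->
  max_eigenvalue_simple (P *m P^T) ->
  forall E : 'M[R]_(N, n), exists C, forall h : R,
  0 <= dual_norm (P + h *: E) ^+ 2 - dual_norm P ^+ 2
       - 2 * h * frob (e^T *m P) (e^T *m E) <= C * h ^+ 2.
Proof.
move=> e1 eP simpleP E.
have [g g_gt0 gap] := spectral_gap e1 eP simpleP.
set b := frob (e^T *m P) (e^T *m E).
pose K := enorm P * enorm E.
(* The first term pays for absorbing the cross terms into the gap, the second bounds the form of [E]
   on unit vectors. *)
exists (4 * K ^+ 2 / g + enorm E ^+ 2) => h.
have expand (x : 'cV[R]_N) :
    frob (x^T *m (P + h *: E)) (x^T *m (P + h *: E)) =
    frob (x^T *m P) (x^T *m P) + 2 * h * frob (x^T *m P) (x^T *m E)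
    + h ^+ 2 * frob (x^T *m E) (x^T *m E).
  rewrite mulmxDr -scalemxAr !(frobDl, frobDr, frobZl, frobZr).
  by rewrite (frobC (x^T *m E) (x^T *m P)); ring.
apply/andP; split.
  have := dual_norm_sqr_ge (P + h *: E) e.
  rewrite expand eP -(sqr_enorm e) e1 expr1n mulr1 -/b.
  have := mulr_ge0 (sqr_ge0 h) (frob_ge0 (e^T *m E)).
  by lra.
rewrite lerBlDr lerBlDr; apply: (dual_norm_sqr_le e1).
(* The forms are even in [x], so [x] may be replaced by [- x]. *)
move=> x; wlog x_ge0 : x / 0 <= frob e x => [hw x1|x1].
  have [|/ltW ex] := leP 0 (frob e x); first by move/hw; exact.
  have := hw (- x); rewrite frobNr oppr_ge0 => /(_ ex).
  rewrite linearN /= !mulNmx !(frobNl, frobNr) opprK.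
  by rewrite /enorm frobNl frobNr opprK; apply.
(* Completing the square: [4 K |h| s <= g s^2 + 4 K^2 h^2 / g]. *)
rewrite expand; have := gap x x1 x_ge0.
rewrite -[frob (x - e) _]sqr_enorm; set s := enorm (x - e) => gap_x.
have s_ge0 : 0 <= s by rewrite sqrtr_ge0.
have xE : frob (x^T *m E) (x^T *m E) <= enorm E ^+ 2.
  rewrite -sqr_enorm ler_pXn2r ?nnegrE ?sqrtr_ge0 //.
  by apply: le_trans (enorm_mul_le _ _) _; rewrite enorm_tr x1 mul1r.
have bil_le (y z : 'cV[R]_N) :
    `|frob (y^T *m P) (z^T *m E)| <= enorm y * enorm z * K.
  apply: le_trans (normr_frob_le _ _) _; rewrite mulrACA.
  by apply: ler_pM; rewrite ?sqrtr_ge0 // -[X in X * _]enorm_tr enorm_mul_le.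
have dB : `|frob (x^T *m P) (x^T *m E) - b| <= 2 * s * K.
  have -> : frob (x^T *m P) (x^T *m E) - b =
      frob (x^T *m P) ((x - e)^T *m E) + frob ((x - e)^T *m P) (e^T *m E).
    by rewrite linearB /= !mulmxBl !(frobDl, frobDr, frobNl, frobNr) /b; ring.
  apply: le_trans (ler_normD _ _) _.
  have := lerD (bil_le x (x - e)) (bil_le (x - e) e).
  by rewrite x1 e1 -/s => /le_trans; apply; lra.
have hdB : h * (frob (x^T *m P) (x^T *m E) - b) <= `|h| * (2 * s * K).
  by apply: le_trans (ler_norm _) _; rewrite normrM ler_wpM2l.
have h2 : `|h| ^+ 2 = h ^+ 2 by rewrite real_normK ?num_real.
have := mulr_ge0 (sqr_ge0 h) (_ : 0 <= enorm E ^+ 2 - frob (x^T *m E) (x^T *m E)).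
rewrite subr_ge0 => /(_ xE) hE.
have sq : 0 <= (g * s - 2 * K * `|h|) ^+ 2 / g by rewrite divr_ge0 ?sqr_ge0 ?ltW.
have sqE : (g * s - 2 * K * `|h|) ^+ 2 / g
    = g * s ^+ 2 - 4 * `|h| * s * K + 4 * K ^+ 2 / g * h ^+ 2.
  by rewrite -h2; field; rewrite gt_eqF.
by rewrite sqE in sq; lra.
Qed.

(** The difference quotient misses its limit by [d / (2 * h)] with [0 <= d <= C * h ^+ 2], which is
    of order [h]. *)
Lemma is_derive_dual_hamiltonian (P : 'M[R]_(N, n)) (e : 'cV[R]_N) :
  enorm e = 1 -> frob (e^T *m P) (e^T *m P) = dual_norm P ^+ 2 ->
  max_eigenvalue_simple (P *m P^T) ->
  forall E : 'M[R]_(N, n),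
  is_derive P E (@dual_hamiltonian R N n) (frob (e^T *m P) (e^T *m E)).
Proof.
move=> e1 eP simpleP E.
have [C expand] := dual_norm_sqr_expansion e1 eP simpleP E.
set b := frob (e^T *m P) (e^T *m E) in expand *.
suff cv : h^-1 *: (dual_hamiltonian (h *: E + P) - dual_hamiltonian P)
          @[h --> (0 : R)^'] --> b.
  by split; [apply/cvg_ex; exists b|apply: cvg_lim].
apply/cvgrPdist_le => eps eps_gt0; near=> h.
have h_neq0 : h != 0 by near: h; exact: nbhs_dnbhs_neq.
have h_small : `|h| <= eps / (`|C| + 1).
  by near: h; apply: dnbhs0_le; rewrite divr_gt0 // ltr_wpDl.
have /andP[lo hi] := expand h.
set d := _ - _ - _ in lo hi.
rewrite distrC /GRing.scale /= /dual_hamiltonian [h *: E + P]addrC.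
have -> : h^-1 * (2^-1 * dual_norm (P + h *: E) ^+ 2 - 2^-1 * dual_norm P ^+ 2) - b
          = (2 * h)^-1 * d.
  by rewrite /d; field.
have h_gt0 : 0 < `|h| by rewrite normr_gt0.
rewrite normrM normfV normrM gtr0_norm // (ger0_norm lo) mulrC.
rewrite ler_pdivrMr ?mulr_gt0 //; apply: le_trans hi _.
move: h_small; rewrite ler_pdivlMr ?ltr_wpDl // => h_small.
rewrite -real_normK ?num_real //.
have := ler_wpM2r (sqr_ge0 `|h|) (ler_norm C).
have := ler_wpM2l (ltW h_gt0) h_small.
have := mulr_gt0 eps_gt0 h_gt0.
have := sqr_ge0 `|h|.
by lra.
Unshelve. all: by end_near.
Qed.

End Derivative.

(** * Projection identity for the tangential Aronsson operator *)

Unset Implicit Arguments.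

(* The first conjunct makes explicit that the derivatives H_{P_{a i}}(Du)
   occurring in the tangential Aronsson operator exist. *)
Theorem proposition3p1 (R : realType) (n N : nat)
    (u e : 'cV[R]_n -> 'cV[R]_N)
    (hu : is_Cvec 2 u)
    (he : is_Cvec 1 e)
    (he1 : forall x, enorm (e x) = 1)
    (hmax : forall x, dual_norm (grad u x) ^+ 2
                      = frob (grad u x *m (grad u x)^T) (outer (e x) (e x)))
    (hsimple : forall x, max_eigenvalue_simple (grad u x *m (grad u x)^T)) :
  forall x : 'cV[R]_n,
    (forall (a : 'I_N) (i : 'I_n),
       derivable (@dual_hamiltonian R N n) (grad u x) (delta_mx a i)) /\
    tangential_Aronsson (@dual_hamiltonian R N n) u x
    = outer (e x) (e x) *m dual_infty_laplacian e u x.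
Proof.
move=> x.
have e1 := he1 x; set P := grad u x.
have eP : frob ((e x)^T *m P) ((e x)^T *m P) = dual_norm P ^+ 2.
  by rewrite hmax frob_trmulC frob_mul trmxK /outer -mulmxA.
have dH := is_derive_dual_hamiltonian e1 eP (hsimple x).
split=> [a i|]; first by have [] := dH (delta_mx a i).
(* Pairing with [delta_mx a i] reads off the entries of the rank-one gradient. *)
have HP a i : H_P (@dual_hamiltonian R N n) P a i = e x a 0 * ((e x)^T *m P) 0 i.
  rewrite mxE (@derive_val _ _ _ _ _ _ _ (dH _)).
  by rewrite frobC frob_trmulC frobC frob_delta mxE big_ord1.
have ee : (e x)^T *m e x = 1%:M.
  by rewrite [LHS]mx11_scalar -trace_mx11 mxtrace_mulC -frobE -sqr_enorm e1 expr1n.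
(* The projection fixes [e x], and therefore annihilates the range of its complement. *)
have oe : outer (e x) (e x) *m e x = e x by rewrite /outer -mulmxA ee mulmx1.
rewrite /dual_infty_laplacian mulmxDr mulmxA mulmxBr mulmx1.
rewrite [outer _ _ *m outer _ _]mulmxA oe subrr mul0mx addr0 -scalemxAr oe.
apply/matrixP => a j; rewrite !ord1 !mxE -/P mulrC.
(* The triple sum over [b], [i], [j] is reordered with [b] innermost, as in the contraction with
   [eD2u]. *)
rewrite /frob mulr_sumr exchange_big; apply: eq_bigr => i _ /=.
rewrite mulr_sumr exchange_big; apply: eq_bigr => k _ /=.
rewrite [X in _ * (X * _)]mxE big_ord1 [X in _ * (_ * X)]mxE !mulr_sumr.
by apply: eq_bigr => b _; rewrite !HP !mxE; ring.
Qed.
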